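(* Let $\mathcal U\subset\mathbb R^{n_\xi}$ be convex (and compact), and let $f:\mathcal X\times\mathcal Y\times\mathcal U\to\mathbb R$ be a continuous function such that $\xi\mapsto f(x,y,\xi)$ is concave for every $x\in\mathcal X$, $y\in\mathcal Y$. Furthermore, assume that $f$ is Lipschitz continuous in $y$, i.e., there exists a constant $L>0$ such that $$|f(x,y,\xi)-f(x,y',\xi)|\le L\|y-y'\|\qquad\forall x\in\mathcal X,\ \xi\in\mathcal U,\ y,y'\in\mathcal Y.$$ Then, for any $s,k\in\mathbb N$ (positive integers) with $s\le k$ it holds $$\mathrm{opt}(s)-\mathrm{opt}(k)\le L\,\mathrm{diam}(\mathcal Y)\,\ln\!\left(\frac ks\right).$$
   Context: $\mathcal X\subseteq\mathbb R^{n_x}$ is a nonempty compact set, $\mathcal Y\subset\mathbb Z^{n_y}$ is a bounded (hence finite) set, for each $x\in\mathcal X$ a nonempty set $\mathcal Y(x)\subseteq\mathcal Y$ is given, and $\mathcal U$ is nonempty. For a positive integer $k$, the optimal value of the $k$-adaptability problem is $$\mathrm{opt}(k):=\inf_{\substack{x\in\mathcal X\\ y^1,\ldots,y^k\in\mathcal Y(x)}}\ \sup_{\xi\in\mathcal U}\ \inf_{i=1,\ldots,k} f(x,y^i,\xi),$$ where the $y^i$ need not be distinct. $\|\cdot\|$ is the Euclidean norm and $\mathrm{diam}(\mathcal Y)=\max_{y,y'\in\mathcal Y}\|y-y'\|$. *)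

(* Defs.v *)
From mathcomp Require Export all_boot all_order all_algebra.
From mathcomp Require Export all_classical all_reals all_analysis.
Export Order.TTheory GRing.Theory Num.Theory.
Export numFieldNormedType.Exports.

Set Implicit Arguments.
Unset Strict Implicit.
Unset Printing Implicit Defensive.

Local Open Scope classical_set_scope.
Local Open Scope ring_scope.

(* The Euclidean norm has to be introduced: `|v| on 'rV[R]_n is the sup norm.
   Both induce the same topology and the same bounded sets. *)
Definition enorm (R : realType) (n : nat) (v : 'rV[R]_n) : R :=
  Num.sqrt (\sum_(j < n) v 0 j ^+ 2).

(* Real supremum, which is the maximum when Y is finite and nonempty. *)
Definition diam (R : realType) (n : nat) (Y : set 'rV[R]_n) : R :=
  sup [set d | exists y y', [/\ Y y, Y y' & d = enorm (y - y')]].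

Definition integer_points (R : realType) (n : nat) : set 'rV[R]_n :=
  [set y | forall j, y 0 j \is a Num.int].

(* The library's convex_function with the inequality reversed. *)
Definition concave_function (R : realType) (E : lmodType R)
    (D : set E) (g : E -> R) : Prop :=
  forall (t : {i01 R}) (u v : E), D u -> D v ->
    t%:num * g u + (1 - t%:num) * g v <= g (t%:num *: u + (1 - t%:num) *: v).

(* The family i |-> y i need not be injective.  The infima and suprema are
   taken in \bar R so that none of them falls back on a default value. *)
Definition opt (R : realType) (nx ny nxi : nat)
    (X : set 'rV[R]_nx) (Yof : 'rV[R]_nx -> set 'rV[R]_ny)
    (U : set 'rV[R]_nxi)
    (f : 'rV[R]_nx -> 'rV[R]_ny -> 'rV[R]_nxi -> R) (k : nat) : \bar R :=
  ereal_inf [set v | exists (x : 'rV[R]_nx) (y : 'I_k -> 'rV[R]_ny),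
    [/\ X x, (forall i, Yof x (y i)) &
        v = ereal_sup
              [set ereal_inf (range (fun i => (f x (y i) xi)%:E)) | xi in U]]].

(* Main.v *)
(* Fix x and y_1, ..., y_{k+1}, and let w bound min_i f(x, y_i, xi) over xi in U.
   By a minimax argument there are convex weights lam with
   sum_i lam_i f(x, y_i, xi) <= w on U.  Some lam_i is at most 1/(k+1); dropping
   that y_i raises the bound by at most lam_i L diam(Y), because the dropped
   value is within L diam(Y) of the others.  Hence
   opt(k) <= opt(k+1) + L diam(Y)/(k+1), and 1/(k+1) <= ln((k+1)/k) telescopes. *)
Require Import Defs.
From mathcomp Require Import ring lra.

Set Implicit Arguments.
Unset Strict Implicit.
Unset Printing Implicit Defensive.

Local Open Scope classical_set_scope.
Local Open Scope ring_scope.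

(** * Convexity and a theorem of the alternative for concave functions *)

Lemma convex_setE (R : realType) (E : lmodType R) (U : set E) (a b : E) (t : R) :
  convex_set U -> U a -> U b -> 0 <= t <= 1 -> U (t *: a + (1 - t) *: b).
Proof.
move=> Uc Ua Ub t01.
have := Uc a b (Itv01 (andP t01).1 (andP t01).2) (mem_set Ua) (mem_set Ub).
by move/set_mem.
Qed.

Lemma concave_functionE (R : realType) (E : lmodType R) (U : set E)
    (g : E -> R) (a b : E) (t : R) :
  concave_function U g -> U a -> U b -> 0 <= t <= 1 ->
  t * g a + (1 - t) * g b <= g (t *: a + (1 - t) *: b).
Proof.
by move=> gc Ua Ub t01; have := gc (Itv01 (andP t01).1 (andP t01).2) a b Ua Ub.
Qed.

Lemma concave_sum (R : realType) (E : lmodType R) (U : set E) (I : finType)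
    (f : I -> E -> R) (lam : I -> R) :
  (forall i, 0 <= lam i) -> (forall i, concave_function U (f i)) ->
  concave_function U (fun u => \sum_i lam i * f i u).
Proof.
move=> lam0 fc t u v Uu Uv; rewrite !big_distrr/= -big_split/=.
apply: ler_sum => i _; rewrite (mulrCA t%:num) (mulrCA (1 - t%:num)) -mulrDr.
apply: (ler_wpM2l (lam0 i)).
exact: (fc i t u v Uu Uv).
Qed.

(* Otherwise the point dividing [a, b] in the ratio g b - f b : f a - g a makes
   both f and g positive. *)
Lemma concave_cross (R : realType) (E : lmodType R) (U : set E)
    (f g : E -> R) (a b : E) :
  convex_set U -> concave_function U f -> concave_function U g ->
  (forall u, U u -> f u <= 0 \/ g u <= 0) ->
  U a -> U b -> 0 < f a -> 0 < g b -> f a * g b <= g a * f b.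
Proof.
move=> Uc fc gc fg Ua Ub fa gb; rewrite leNgt; apply/negP => lt.
have ga : g a <= 0 by case: (fg a Ua) => //; lra.
have fb : f b <= 0 by case: (fg b Ub) => //; lra.
set w := g b - f b; set w' := f a - g a.
have w0 : 0 < w by rewrite /w; lra.
have w'0 : 0 < w' by rewrite /w'; lra.
have ww : 0 < w + w' by lra.
set t := w / (w + w').
have t01 : 0 <= t <= 1.
  by rewrite /t ler_pdivrMr// mul1r divr_ge0/=; lra.
have t' : 1 - t = w' / (w + w') by rewrite /t; field; lra.
have := concave_functionE fc Ua Ub t01; have := concave_functionE gc Ua Ub t01.
(* This [t] makes both chords take the same value, positive by [lt]. *)
have -> : t * f a + (1 - t) * f b = (f a * g b - g a * f b) / (w + w').
  by rewrite t' /t /w /w'; field; rewrite /w /w' in ww; lra.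
have -> : t * g a + (1 - t) * g b = (f a * g b - g a * f b) / (w + w').
  by rewrite t' /t /w /w'; field; rewrite /w /w' in ww; lra.
have : 0 < (f a * g b - g a * f b) / (w + w') by rewrite divr_gt0// subr_gt0.
by case: (fg _ (convex_setE Uc Ua Ub t01)); lra.
Qed.

(** Points with [g b > 0] bound [lam] from below by [g b / (g b - f b)], points with [f u > 0] bound
    it from above by [- g u / (f u - g u)]. By [concave_cross] no lower bound exceeds an upper one,
    so the supremum [S] of the lower bounds serves as the weight. *)
Lemma concave_alternative2 (R : realType) (E : lmodType R) (U : set E)
    (f g : E -> R) :
  convex_set U -> concave_function U f -> concave_function U g ->
  (forall u, U u -> f u <= 0 \/ g u <= 0) ->
  exists2 lam : R, 0 <= lam <= 1 &
    forall u, U u -> lam * f u + (1 - lam) * g u <= 0.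
Proof.
move=> Uc fc gc fg.
pose S := [set l | l = 0 \/
  exists b, [/\ U b, 0 < g b & l = g b / (g b - f b)]].
have S0 : S 0 by left.
have S1 : ubound S 1.
  move=> l [->//|[b [Ub gb ->]]].
  have fb : f b <= 0 by case: (fg b Ub) => //; lra.
  by rewrite ler_pdivrMr ?mul1r; lra.
have Ss : has_sup S by split; [exists 0|exists 1].
have l0 : 0 <= sup S by exact: sup_upper_bound.
have l1 : sup S <= 1 by apply: ge_sup => //; exists 0.
exists (sup S) => [|u Uu]; first by rewrite l0.
have [fu|fu] := leP (f u) 0; last first.
  have gu : g u <= 0 by case: (fg u Uu) => //; lra.
  suff : sup S <= - g u / (f u - g u).
    by rewrite ler_pdivlMr ?subr_gt0; lra.
  apply: ge_sup => [|l [->|[b [Ub gb ->]]]]; first by exists 0.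
    by rewrite divr_ge0; lra.
  have fb : f b <= 0 by case: (fg b Ub) => //; lra.
  have := concave_cross Uc fc gc fg Uu Ub fu gb.
  rewrite ler_pdivrMr; last lra.
  by rewrite mulrAC ler_pdivlMr; lra.
have [gu|gu] := leP (g u) 0.
  have : sup S * - f u >= 0 by rewrite mulr_ge0; lra.
  have : (1 - sup S) * - g u >= 0 by rewrite mulr_ge0; lra.
  lra.
have : g u / (g u - f u) <= sup S.
  by apply: sup_upper_bound => //; right; exists u.
by rewrite ler_pdivrMr ?subr_gt0; lra.
Qed.

(* Induction on the number of functions: on the convex set where f_0 > 0 the
   other functions admit weights, and the resulting combination is paired with
   f_0. *)
Lemma concave_alternative (R : realType) (E : lmodType R) (n : nat)
    (U : set E) (f : 'I_n.+1 -> E -> R) :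
  convex_set U -> (forall i, concave_function U (f i)) ->
  (forall u, U u -> exists i, f i u <= 0) ->
  exists lam : 'I_n.+1 -> R, [/\ forall i, 0 <= lam i, \sum_i lam i = 1 &
    forall u, U u -> \sum_i lam i * f i u <= 0].
Proof.
elim: n U f => [|n IH] U f Uc fc fU.
  exists (fun=> 1); split=> [i||u Uu] //; first by rewrite big_ord1.
  by rewrite big_ord1 mul1r; have [i] := fU u Uu; rewrite ord1.
pose V := U `&` [set u | 0 < f ord0 u].
have Vc : convex_set V.
  move=> a b t /set_mem[Ua fa] /set_mem[Ub fb]; apply/mem_set; split.
    exact/set_mem/(Uc a b t)/mem_set/Ub/mem_set.
  apply: lt_le_trans (fc ord0 t a b Ua Ub).
  have t0 : 0 <= t%:num by [].
  have t1 : t%:num <= 1 by [].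
  move: fa fb => /= fa fb.
  (* Strict positivity comes from [f ord0 a] if [t > 0] and from [f ord0 b] if [t = 0]. *)
  have [->|tn0] := eqVneq t%:num 0; first by rewrite mul0r add0r subr0 mul1r.
  apply: ltr_pwDl; first by rewrite mulr_gt0// lt_def tn0.
  by rewrite mulr_ge0 ?subr_ge0// ltW.
have [|i|u [Uu fu]|mu [mu0 mu1 muV]] := IH V (fun i => f (lift ord0 i)).
- exact: Vc.
- by move=> t a b [Ua _] [Ub _]; exact: fc.
- have [i] := fU u Uu; case: (unliftP ord0 i) => [j ->|->]; first by exists j.
  by rewrite leNgt fu.
have [|||lam /andP[lam0 lam1] lamU] := @concave_alternative2 _ _ U (f ord0)
    (fun u => \sum_i mu i * f (lift ord0 i) u) Uc.
- exact: fc.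
- exact: concave_sum.
- by move=> u Uu; have [|fu] := leP (f ord0 u) 0; [left|right; exact: muV].
exists (fun i => oapp (fun j => (1 - lam) * mu j) lam (unlift ord0 i)); split.
- by move=> i; case: unliftP => //= j _; rewrite mulr_ge0// subr_ge0.
- rewrite big_ord_recl unlift_none/=.
  under eq_bigr do rewrite liftK/=.
  by rewrite -big_distrr/= mu1 mulr1 addrC subrK.
move=> u Uu; rewrite big_ord_recl unlift_none/=.
under eq_bigr do rewrite liftK/= -mulrA.
by rewrite -big_distrr/=; exact: lamU.
Qed.

Lemma drop_one_function (R : realType) (E : lmodType R) (n : nat) (U : set E)
    (f : 'I_n.+2 -> E -> R) (w d : R) :
  convex_set U -> (forall i, concave_function U (f i)) ->
  (forall u, U u -> exists i, f i u <= w) ->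
  (forall i j u, U u -> f i u - f j u <= d) ->
  exists i0, forall u, U u -> exists j, f (lift i0 j) u <= w + d / n.+2%:R.
Proof.
move=> Uc fc fw fd.
have [|i t a b Ua Ub|u Uu|lam [lam0 lam1 lamU]] :=
    @concave_alternative _ _ _ U (fun i u => f i u - w).
- exact: Uc.
- by have := fc i t a b Ua Ub; lra.
- by have [i fi] := fw u Uu; exists i; rewrite subr_le0.
have [i0 lami0] : exists i, lam i <= n.+2%:R^-1.
  apply/existsP; apply: contraT => /existsPn lamn.
  have : \sum_(i < n.+2) n.+2%:R^-1 < \sum_i lam i.
    apply: ltr_sum => [|i _]; last by rewrite ltNge lamn.
    by apply/hasP; exists ord0; rewrite ?mem_index_enum.
  by rewrite lam1 sumr_const card_ord -[_ *+ _]mulr_natr mulVf// ltxx.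
exists i0 => u Uu.
pose j0 := [arg min_(j < ord0) f (lift i0 j) u]%O.
have j0P j : f (lift i0 j0) u <= f (lift i0 j) u.
  by rewrite /j0; case: arg_minP => // j1 _ /(_ j); apply.
exists j0; set m := f (lift i0 j0) u.
have d0 : 0 <= d by rewrite -(subrr (f i0 u)) fd.
(* Each kept value is at least [m] and the dropped one at least [m - d]; averaging gives
   [m - w - lam i0 * d <= 0]. *)
have : \sum_i lam i * (m - w - (if i == i0 then d else 0))
     <= \sum_i lam i * (f i u - w).
  apply: ler_sum => i _; apply: (ler_wpM2l (lam0 i)).
  case: (unliftP i0 i) => [j ->|->].
    by rewrite eq_sym (negbTE (neq_lift _ _)) subr0 lerD2r.
  by rewrite eqxx; have := fd (lift i0 j0) i0 u Uu; rewrite -/m; lra.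
move/le_trans/(_ (lamU u Uu)).
under eq_bigr do rewrite mulrBr.
rewrite sumrB -big_distrl/= lam1 mul1r.
rewrite (bigD1 i0)//= eqxx big1 ?addr0; last first.
  by move=> i /negbTE ->; rewrite mulr0.
have : lam i0 * d <= d / n.+2%:R by rewrite mulrC; exact: ler_wpM2l.
move: (_ / _) => c; lra.
Qed.

(** * The diameter, finite infima and a logarithm estimate *)

Lemma enorm_le_diam (R : realType) (n : nat) (Y : set 'rV[R]_n)
    (y y' : 'rV[R]_n) :
  bounded_set Y -> Y y -> Y y' -> enorm (y - y') <= diam Y.
Proof.
move=> [M0 [_ /(_ (M0 + 1))]]; rewrite ltrDl => /(_ ltr01).
move: (M0 + 1) => {M0} M YM Yy Yy'.
(* A real [sup] is meaningful only for a set bounded above; the bound comes from coordinates of size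
   at most [M]. *)
apply: sup_upper_bound; last by exists y, y'.
split; first by exists (enorm (y - y')), y, y'.
exists (Num.sqrt (\sum_(j < n) (M + M) ^+ 2)) => _ [z [z' [Yz Yz' ->]]].
apply: ler_wsqrtr; apply: ler_sum => j _.
have coord (v : 'rV[R]_n) : Y v -> `|v 0 j| <= M.
  move=> /YM; apply: le_trans; rewrite [leRHS]mx_normrE.
  exact: (le_bigmax _ (fun ij => `|v ij.1 ij.2|) (0, j)).
have M_ge0 : 0 <= M by apply: le_trans (coord _ Yz).
rewrite !mxE -real_normK ?num_real// lerXn2r ?nnegrE ?addr_ge0//.
apply: le_trans (ler_normB _ _) _.
by rewrite lerD ?coord.
Qed.

(** A finite nonempty family attains its infimum. *)
Lemma ereal_inf_range_le (R : realType) (n : nat) (g : 'I_n.+1 -> R) (w : R) :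
  (ereal_inf (range (fun i => (g i)%:E)) <= w%:E)%E <-> exists i, g i <= w.
Proof.
split=> [gw|[i gi]]; last first.
  by apply: ge_ereal_inf; exists (g i)%:E; rewrite ?lee_fin//; exists i.
pose i0 := [arg min_(i < ord0) g i]%O.
exists i0; rewrite -lee_fin; apply: le_trans gw; apply: le_ereal_inf_tmp.
move=> _ [i _ <-]; rewrite lee_fin /i0.
by case: arg_minP => // j _ /(_ i); apply.
Qed.

(** This is [ln (1 + x) <= x] at [x = - k.+2%:R^-1], after inverting the ratio. *)
Lemma inv_le_ln_ratio (R : realType) (k : nat) :
  (k.+2%:R^-1 : R) <= ln (k.+2%:R / k.+1%:R).
Proof.
have k2 : (0 : R) < k.+2%:R by [].
have k1 : (0 : R) < k.+1%:R by [].
rewrite -[ln _]opprK lerNr -lnV ?posrE ?divr_gt0// invf_div.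
have -> : k.+1%:R / k.+2%:R = 1 + - k.+2%:R^-1 :> R.
  by rewrite -[k.+2]addn1 natrD; field; lra.
by apply: le_ln1Dx; rewrite ltrN2 invf_lt1// ltr1n.
Qed.

(** * Comparison of consecutive values of [opt] *)

Section opt_bounds.
Context (R : realType) (nx ny nxi : nat).
Variables (X : set 'rV[R]_nx) (Y : set 'rV[R]_ny).
Variables (Yof : 'rV[R]_nx -> set 'rV[R]_ny) (U : set 'rV[R]_nxi).
Variables (f : 'rV[R]_nx -> 'rV[R]_ny -> 'rV[R]_nxi -> R) (d : R).
Hypothesis Yof_sub : forall x, X x -> Yof x `<=` Y.
Hypothesis U_convex : convex_set U.
Hypothesis f_concave : forall x y, X x -> Y y -> concave_function U (f x y).
Hypothesis f_osc : forall x xi y y', X x -> U xi -> Y y -> Y y' ->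
  f x y xi - f x y' xi <= d.

Lemma opt_le (k : nat) (x : 'rV[R]_nx) (y : 'I_k.+1 -> 'rV[R]_ny) (w : R) :
  X x -> (forall i, Yof x (y i)) ->
  (forall xi, U xi -> exists i, f x (y i) xi <= w) ->
  (opt X Yof U f k.+1 <= w%:E)%E.
Proof.
move=> Xx yP fw; apply: ge_ereal_inf.
eexists; first by exists x, y; split; [| |reflexivity].
by apply: ge_ereal_sup => _ [xi Uxi <-]; apply/ereal_inf_range_le; exact: fw.
Qed.

Lemma opt_succ (k : nat) :
  (opt X Yof U f k.+1 <= opt X Yof U f k.+2 + (d / k.+2%:R)%:E)%E.
Proof.
rewrite -leeBlDr//; apply: le_ereal_inf_tmp => v [x [y [Xx yP ->]]].
rewrite leeBlDr//; set V := ereal_sup _.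
(* Stated for every real bound [w], since [V] may be infinite: if [V] is [-oo], every real qualifies
   and [opt] at [k.+1] is [-oo] too. *)
have step w : (V <= w%:E)%E -> (opt X Yof U f k.+1 <= (w + d / k.+2%:R)%:E)%E.
  move=> Vw; have [||xi Uxi|i j xi Uxi|i0 i0P] :=
    @drop_one_function _ _ k U (fun i => f x (y i)) w d.
  - exact: U_convex.
  - by move=> i; apply: f_concave => //; exact: Yof_sub (yP i).
  - apply/ereal_inf_range_le; apply: le_trans Vw.
    by apply: ereal_sup_ubound; exists xi.
  - by apply: f_osc => //; exact: Yof_sub (yP _).
  exact: (@opt_le k x (fun j => y (lift i0 j))).
case: V step => [r|_|step]; first by move=> /(_ r); rewrite lexx -EFinD; apply.
  by rewrite leey.
rewrite (@eq_ninfty _ (opt X Yof U f k.+1)) ?leNye// => r.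
by have := step (r - d / k.+2%:R) (leNye _); rewrite subrK.
Qed.

End opt_bounds.

(** * Telescoping from [s] to [k] *)

Theorem theorem7 (R : realType) (nx ny nxi : nat)
    (X : set 'rV[R]_nx) (Y : set 'rV[R]_ny)
    (Yof : 'rV[R]_nx -> set 'rV[R]_ny) (U : set 'rV[R]_nxi)
    (f : 'rV[R]_nx -> 'rV[R]_ny -> 'rV[R]_nxi -> R) (L : R)
    (X_neq0 : X !=set0) (X_compact : compact X)
    (Y_int : Y `<=` @integer_points R ny) (Y_bounded : bounded_set Y)
    (Yof_sub : forall x, X x -> Yof x `<=` Y)
    (Yof_neq0 : forall x, X x -> Yof x !=set0)
    (U_neq0 : U !=set0) (U_convex : convex_set U) (U_compact : compact U)
    (f_cont : {within X `*` Y `*` U,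
       continuous (fun z : 'rV[R]_nx * 'rV[R]_ny * 'rV[R]_nxi =>
                     f z.1.1 z.1.2 z.2)})
    (f_concave : forall x y, X x -> Y y -> concave_function U (f x y))
    (L_gt0 : 0 < L)
    (f_lip : forall x xi y y', X x -> U xi -> Y y -> Y y' ->
       `|f x y xi - f x y' xi| <= L * enorm (y - y'))
    (s k : nat) (s_gt0 : (0 < s)%N) (s_le_k : (s <= k)%N) :
  (opt X Yof U f s - opt X Yof U f k
     <= (L * diam Y * ln (k%:R / s%:R))%:E)%E.
Proof.
set d := L * diam Y.
have f_osc x xi y y' : X x -> U xi -> Y y -> Y y' ->
    f x y xi - f x y' xi <= d.
  move=> Xx Uxi Yy Yy'; apply: (le_trans (ler_norm _)).
  apply: (le_trans (f_lip _ _ _ _ Xx Uxi Yy Yy')).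
  by rewrite ler_pM2l// enorm_le_diam.
have d0 : 0 <= d.
  have [[x Xx] [xi Uxi]] := (X_neq0, U_neq0); have [y yP] := Yof_neq0 x Xx.
  have Yy : Y y by exact: Yof_sub yP.
  by rewrite -(subrr (f x y xi)) f_osc.
have telescope : (opt X Yof U f s <= opt X Yof U f k + (d * ln (k%:R / s%:R))%:E)%E.
  case: s s_gt0 s_le_k => // s' _; elim: k => // k' IH.
  rewrite leq_eqVlt => /predU1P[->|]; first by rewrite divff// ln1 mulr0 adde0.
  rewrite ltnS => sk; apply: le_trans (IH sk) _.
  (* Here [k'] is at least [s'.+1], hence a successor, as [opt_succ] requires. *)
  case: k' sk {IH} => // k' sk.
  apply: (le_trans (leeD2r _ (opt_succ Yof_sub U_convex f_concave f_osc k'))).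
  rewrite -addeA leeD2l// -EFinD lee_fin -mulrDr.
  apply: (ler_wpM2l d0).
  have -> : k'.+2%:R / s'.+1%:R = k'.+2%:R / k'.+1%:R * (k'.+1%:R / s'.+1%:R) :> R.
    by rewrite mulrA divfK.
  by rewrite [ln (_ / _ * _)]lnM ?posrE ?divr_gt0// lerD2r inv_le_ln_ratio.
(* In a sum of opposite infinities [-oo] wins, so both infinite cases give a left-hand side of
   [-oo]; if [opt] at [k] is [-oo], [telescope] forces the same at [s]. *)
move: telescope; case: (opt X Yof U f k) => [r||].
- by rewrite leeBlDl.
- by rewrite /= addeNy leNye.
- by rewrite addNye leeNy_eq => /eqP ->; rewrite addNye leNye.
Qed.
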